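(* Let $p:X\to Y$ be a covering branched over $S\subset Y$. Let $a\in Y\setminus S$ and $\hat a\in p^{-1}(a)$. For each open connected $U\subset Y$, let $\pi_1(a,p,U)$ be the set of paths with fixed start $a$ and free end in $U$, up to $p$-homotopy. Then for all $b\in Y$ and all bases $\mathcal B$ of connected open neighborhoods of $b$ there is a homeomorphism $$p^{-1}(b)\simeq\varprojlim_{U\in\mathcal B}\pi_1(a,p,U),$$ with respect to the natural bonding maps $\pi_1(a,p,U)\to\pi_1(a,p,V)$ for $U\subset V$.
   Context: All topological spaces are Hausdorff, locally path connected and first countable (projective limits are taken in the category of Hausdorff topological spaces). A subset $D$ of a space $X$ is locally connected in $X$ if $U\cap D$ is connected for every open connected $U\subset X$. A subset is portly in $X$ if it is open, dense and locally connected in $X$. A spread $p:X\to Y$ is a continuous map such that the connected components of preimages $p^{-1}(U)$ of open subsets $U\subset Y$ generate the topology of $X$. It is complete if for every $y\in\overline{p(X)}$ and every inclusion-increasing assignment $\chi$ associating to each open connected neighborhood $U$ of $y$ a connected component $\chi(U)$ of $p^{-1}(U)$, one has $\bigcap_U\chi(U)\neq\emptyset$. The ordinary locus $\mathrm{Ord}(Y)$ is the set of $y\in Y$ having an open neighborhood $U$ such that each connected component of $p^{-1}(U)$ is mapped homeomorphically onto $U$ by $p$, and $\mathrm{Ord}(X)=p^{-1}(\mathrm{Ord}(Y))$. A branched covering is a complete surjective spread $X\to Y$ with $X,Y$ connected and $\mathrm{Ord}(X)$, $\mathrm{Ord}(Y)$ portly in $X$, $Y$. It is branched over $S$ if $S=Y\setminus\mathrm{Ord}(Y)$.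 The paths considered are paths in $Y\setminus S$ starting at $a$ and ending in $U\setminus S$; they lift uniquely to $\mathrm{Ord}(X)$ once the start point of the lift is prescribed. Two such paths are $p$-homotopic (relative to $U$) if their lifts starting at the same point $\hat a$ end in the same connected component of $p^{-1}(U)$. The sets $\pi_1(a,p,U)$ carry the discrete topology. *)

(* Defs.v *)
From HB Require Import structures.
From mathcomp Require Import all_boot all_order all_algebra generic_quotient.
From mathcomp Require Import all_classical all_reals.
From mathcomp Require Import topology normedtype.

Set Implicit Arguments.
Unset Strict Implicit.
Unset Printing Implicit Defensive.

Import Order.TTheory GRing.Theory Num.Theory numFieldNormedType.Exports.

Local Open Scope classical_set_scope.
Local Open Scope ring_scope.
Local Open Scope quotient_scope.

Definition homeomorphism (T1 T2 : topologicalType) (f : T1 -> T2) : Prop :=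
  continuous f /\
  exists g : T2 -> T1, [/\ continuous g, cancel f g & cancel g f].

Definition homeomorphic (T1 T2 : topologicalType) : Prop :=
  exists f : T1 -> T2, homeomorphism f.

(* Here [A] and [B] are coerced to [set_type], with the subspace topology. *)
Definition maps_homeomorphically (T1 T2 : topologicalType) (f : T1 -> T2)
    (A : set T1) (B : set T2) : Prop :=
  exists h : A -> B,
    homeomorphism h /\ forall x : A, set_val (h x) = f (set_val x).

Definition nbhs_basis (T : topologicalType) (x : T) (B : set (set T)) : Prop :=
  (forall U, B U -> nbhs x U) /\
  (forall W, nbhs x W -> exists2 U, B U & U `<=` W).

Definition first_countable (T : topologicalType) : Prop :=
  forall x : T, exists2 B, countable B & nbhs_basis x B.

(* A path in [A] is represented by a function on the whole of [R] of which only
   the restriction to the unit interval matters. *)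
Definition path_in (R : realType) (T : topologicalType) (A : set T)
    (g : R -> T) : Prop :=
  {within `[0, 1], continuous g} /\ g @` `[0, 1] `<=` A.

Definition path_connected (R : realType) (T : topologicalType)
    (A : set T) : Prop :=
  forall x y, A x -> A y -> exists g : R -> T, [/\ path_in A g, g 0 = x & g 1 = y].

Definition locally_path_connected (R : realType) (T : topologicalType) : Prop :=
  forall (x : T) (W : set T), nbhs x W ->
    exists U, [/\ open U, U x, path_connected R U & U `<=` W].

Record admissible (R : realType) (T : topologicalType) : Prop := Admissible {
  admissible_hausdorff : hausdorff_space T;
  admissible_lpc : locally_path_connected R T;
  admissible_first_countable : first_countable T }.

Definition locally_connected_in (T : topologicalType) (D : set T) : Prop :=
  forall U : set T, open U -> connected U -> connected (U `&` D).

Record portly (T : topologicalType) (D : set T) : Prop := Portly {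
  portly_open : open D;
  portly_dense : dense D;
  portly_lc : locally_connected_in D }.

Definition is_component (T : topologicalType) (A C : set T) : Prop :=
  exists2 x, A x & C = connected_component A x.

(* [G] generates the topology as a subbase. *)
Definition generates_topology (T : topologicalType) (G : set (set T)) : Prop :=
  forall A : set T, open A <->
    exists2 F, F `<=` finI_from G id & A = \bigcup_(B in F) B.

Section BranchedCovering.
Variables (X Y : topologicalType) (p : X -> Y).

Definition spread : Prop :=
  continuous p /\
  generates_topology
    [set C | exists2 U : set Y, open U & is_component (p @^-1` U) C].

Definition open_connected_nbhs (y : Y) : set (set Y) :=
  [set U | open_nbhs y U /\ connected U].

Definition complete_spread : Prop :=
  spread /\
  forall (y : Y) (chi : set Y -> set X),
    closure (range p) y ->
    (forall U, open_connected_nbhs y U -> is_component (p @^-1` U) (chi U)) ->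
    (forall U V, open_connected_nbhs y U -> open_connected_nbhs y V ->
       U `<=` V -> chi U `<=` chi V) ->
    \bigcap_(U in open_connected_nbhs y) chi U !=set0.

Definition ordinary_locus : set Y :=
  [set y | exists U : set Y, open_nbhs y U /\
     forall C, is_component (p @^-1` U) C -> maps_homeomorphically p C U].

Record branched_covering : Prop := BranchedCovering {
  branched_complete : complete_spread;
  branched_surjective : set_surj [set: X] [set: Y] p;
  branched_connected_source : connected [set: X];
  branched_connected_target : connected [set: Y];
  branched_portly_source : portly (p @^-1` ordinary_locus);
  branched_portly_target : portly ordinary_locus }.

Definition branched_over (S : set Y) : Prop :=
  branched_covering /\ S = ~` ordinary_locus.

End BranchedCovering.

Section PHomotopy.
Variables (R : realType) (X Y : topologicalType) (p : X -> Y).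
Variables (S : set Y) (a : Y) (ahat : X).

Definition paths_into (U : set Y) : set (R -> Y) :=
  [set g | [/\ path_in (~` S) g, g 0 = a & U (g 1)]].

Definition is_lift (g : R -> Y) (h : R -> X) : Prop :=
  [/\ {within `[0, 1], continuous h}, h 0 = ahat
    & forall t, t \in `[0, 1] -> p (h t) = g t].

(* When [p] is branched over [S] and [p ahat = a], a path in [~` S] starting at
   [a] has a lift, unique on the unit interval, so that the default value is
   not used and [path_lift g 1] does not depend on the choice. *)
Definition path_lift (g : R -> Y) : R -> X :=
  xget (cst ahat) [set h | is_lift g h].

Definition p_homotopic (U : set Y) (g h : paths_into U) : bool :=
  `[< connected_component (p @^-1` U) (path_lift (set_val g) 1)
      = connected_component (p @^-1` U) (path_lift (set_val h) 1) >].

Lemma p_homotopic_equiv U : equiv_class_of (@p_homotopic U).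
Proof.
split=> [g|g h|h g k].
- exact/asboolP.
- by apply/asboolP/asboolP => ->.
- by move=> /asboolP gh /asboolP hk; apply/asboolP; rewrite gh.
Qed.

Canonical p_homotopic_equiv_rel U := EquivRelPack (@p_homotopic_equiv U).

Definition pi1 (U : set Y) : Type := {eq_quot @p_homotopic U}.

HB.instance Definition _ U := Choice.on (pi1 U).
HB.instance Definition _ U := EqQuotient.on (pi1 U).

Definition pi1_class (U : set Y) (g : paths_into U) : pi1 U := \pi_(pi1 U) g.

Lemma paths_intoS (U V : set Y) :
  U `<=` V -> forall g : paths_into U, set_val g \in paths_into V.
Proof.
by move=> UV g; have [] := set_valP g => ? ? ?; rewrite inE; split=> //; exact: UV.
Qed.

Definition widen_path (U V : set Y) (UV : U `<=` V) (g : paths_into U) :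
  paths_into V := SigSub (paths_intoS UV g).

(* The class of [g] goes to the class of [g]; see [bondingE]. *)
Definition bonding (U V : set Y) (UV : U `<=` V) (c : pi1 U) : pi1 V :=
  pi1_class (widen_path UV (repr c)).

Lemma bondingE (U V : set Y) (UV : U `<=` V) :
  (forall g : paths_into U, exists h, is_lift (set_val g) h) ->
  forall g, bonding UV (pi1_class g) = pi1_class (widen_path UV g).
Proof.
move=> ex_lift g.
have liftU (k : paths_into U) : U (p (path_lift (set_val k) 1)).
  have [h kh] := ex_lift k; have [_ _ ->] :
    is_lift (set_val k) (path_lift (set_val k)).
    exact: (xgetPex _ (ex_intro _ h kh)).
  - by have [] := set_valP k.
  - by rewrite in_itv /= ler01 lexx.
have [k gk kE] : exists2 k, p_homotopic g k & repr (pi1_class g) = k.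
  exists (repr (pi1_class g)) => //; apply/asboolP.
  have : pi1_class g = pi1_class (repr (pi1_class g)) by rewrite /pi1_class reprK.
  by move=> /eqmodP /asboolP.
rewrite /bonding kE; apply/eqmodP/asboolP => /=.
move/asboolP: gk => gk.
apply/esym/same_connected_component.
apply: (@connected_component_max _ _
  (connected_component (p @^-1` U) (path_lift (set_val g) 1))).
- exact/connected_component_refl/liftU.
- by move=> x /connected_component_sub; apply: UV.
- exact: component_connected.
- by rewrite gk; exact/connected_component_refl/liftU.
Qed.

End PHomotopy.

(* The subspace of the product formed by the compatible families; it is the
   limit among all topological spaces, hence also among the Hausdorff ones
   when every [T i] is Hausdorff. *)
Definition inverse_limit (I : Type) (le : I -> I -> Prop)
    (T : I -> topologicalType) (f : forall i j, le i j -> T i -> T j) :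
    set (prod_topology T) :=
  [set s | forall i j (ij : le i j), f i j ij (s i) = s j].

Definition pi1_limit (R : realType) (X Y : topologicalType) (p : X -> Y)
    (S : set Y) (a : Y) (ahat : X) (B : set (set Y)) :=
  @inverse_limit B (fun U V => set_val U `<=` set_val V)
    (fun U => discrete_topology (pi1 R p S a ahat (set_val U)))
    (fun U V UV => bonding UV).

Arguments pi1_limit R {X Y} p S a ahat B.

(* Main.v *)
Require Import Defs.
From mathcomp Require Import all_boot all_order all_algebra.
From mathcomp Require Import finmap generic_quotient.
From mathcomp Require Import all_classical all_reals.
From mathcomp Require Import topology normedtype.

(** A class in [pi1 U] is determined by the connected component of
    [p @^-1` U] in which the lifts of its paths end, by the very definition of
    p-homotopy ([end_component_inj]). Conversely every component [C] of
    [p @^-1` U] is reached ([end_component_surj]): [C] is open, so it meets the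
    dense set [Ord(X)], which is open and connected, hence path connected; a
    path in [Ord(X)] from [ahat] to a point of [C] is the lift of its own
    projection. Thus [pi1 U] is the set of components of [p @^-1` U], and the
    bonding maps become the inclusions of components
    ([end_component_bonding]).

    The statement is now about the fibre and the components over a basis of
    neighbourhoods of [b]. A point [x] of the fibre corresponds to the family
    of the components containing it. This determines [x], because the
    components over small neighbourhoods of [b] form a basis at [x]
    ([spread_component_basis]) and [X] is Hausdorff; the same basis makes the
    inverse correspondence continuous, and openness of components gives
    continuity from the fibre to the limit. Every compatible family comes from
    a point ([ends_at_point_exists]): it extends to an increasing choice of components
    over all connected neighbourhoods of [b], to which completeness of the
    spread applies.

    The lifts themselves come from the local sections of [p] over evenly
    covered open sets. Existence and uniqueness of lifts, and the existence of
    paths in [Ord(X)], are all instances of one principle: a property that is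
    locally constant on a connected set is constant
    ([connected_locally_constant]). *)

Set Implicit Arguments.
Unset Strict Implicit.
Unset Printing Implicit Defensive.

Import Order.TTheory GRing.Theory Num.Theory numFieldNormedType.Exports.

Local Open Scope classical_set_scope.
Local Open Scope ring_scope.
Local Open Scope quotient_scope.

(** * Connectedness and continuity *)

Lemma continuous_comp_within (T U V : topologicalType) (A : set U)
    (f : T -> U) (g : U -> V) :
  continuous f -> (forall t, A (f t)) -> {within A, continuous g} ->
  continuous (g \o f).
Proof.
move=> cf Af /subspace_continuousP cg t W Wt.
have : nbhs t (f @^-1` [set y | A y -> W (g y)]) by exact/cf/(cg _ (Af t)).
by apply: filterS => r /(_ (Af r)).
Qed.

(** Both [P] and its negation hold on relatively open subsets of [D], so [P]
    holds on a relatively clopen one. *)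
Lemma connected_locally_constant (T : topologicalType) (D : set T)
    (P : T -> Prop) :
  connected D -> (forall x, D x -> \forall y \near x, D y -> (P y <-> P x)) ->
  forall x y, D x -> D y -> P x -> P y.
Proof.
move=> cD locP x y Dx Dy Px.
have clopen (Q : T -> Prop) :
    (forall z, D z -> \forall w \near z, D w -> (Q w <-> Q z)) ->
    exists2 C, open C & D `&` [set z | Q z] = D `&` C.
  move=> locQ; exists ([set z | D z -> Q z]^°); first exact: open_interior.
  apply/seteqP; split=> z [Dz Qz]; split=> //.
    by apply: filterS (locQ _ Dz) => w wz Dw; apply/(wz Dw).
  exact: (interior_subset Qz).
suff E : D `&` [set z | P z] = D.
  by have [] : (D `&` [set z | P z]) y by rewrite E.
apply: cD; [by exists x | exact: clopen |].
have [z Dz|C oC E] := clopen (fun z => ~ P z).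
  by apply: filterS (locP z Dz) => w wz Dw; rewrite (propext (wz Dw)).
exists (~` C); first exact: open_closedC.
apply/seteqP; split=> z [Dz Pz]; split=> //.
  by move=> Cz; have [] : (D `&` [set z | ~ P z]) z by rewrite E.
by apply: contrapT => nPz; apply: Pz; have [] : (D `&` C) z by rewrite -E.
Qed.

Lemma continuous_prod_topology (I : Type) (K : I -> topologicalType)
    (T : topologicalType) (f : T -> prod_topology K) :
  (forall i, continuous (fun x => f x i)) -> continuous f.
Proof.
move=> cf x; apply/cvg_sup => i.
move=> U [_ [[W oW <-] Wfx WU]].
have : nbhs x [set z | W (f z i)] by apply: (cf i); exact: open_nbhs_nbhs.
by apply: filterS => z; exact: WU.
Qed.

Lemma nbhs_prod_discrete (I : Type) (K : I -> choiceType)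
    (s : prod_topology (fun i => discrete_topology (K i))) (i : I) :
  \forall u \near s, u i = s i.
Proof.
have /cvg_sup/(_ i) h : nbhs s --> s by exact: cvg_id.
apply: (h [set u : forall i, K i | u i = s i]).
exists [set u : forall i, K i | u i = s i]; split=> //.
by exists [set s i : discrete_topology (K i)] => //; exact: discrete_open.
Qed.

(** * Paths on the real line *)

Section Line.
Variable R : realType.
Implicit Types (s t u r : R) (T : topologicalType).

Lemma connected_line : connected [set: R].
Proof. by apply/connected_intervalP => x y _ _ z _. Qed.

(** Precomposing with [clamp 0 1] turns a path, which is only continuous within
    the unit interval, into a function continuous on the whole line. *)
Definition clamp s t r : R := Num.max s (Num.min r t).

Lemma clamp_continuous s t : continuous (clamp s t).
Proof.
have c (x : R) : continuous (fun _ : R => x) by move=> r; exact: cst_continuous.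
apply: (max_fun_continuous (c s)); apply: min_fun_continuous (c t).
by move=> r.
Qed.

Lemma clamp_itv s t r : s <= t -> s <= clamp s t r <= t.
Proof. by move=> st; rewrite le_max lexx ge_max st ge_min lexx orbT. Qed.

Lemma clamp_id s t r : s <= r <= t -> clamp s t r = r.
Proof.
by move=> /andP[sr rt]; rewrite /clamp (min_idPl rt); exact/max_idPr.
Qed.

Lemma continuous_glue T (f g : R -> T) u :
  continuous f -> continuous g -> f u = g u ->
  continuous (fun r => if r <= u then f r else g r).
Proof.
move=> cf cg fg; apply/continuous_subspace_setT.
have -> : [set: R] = `]-oo, u] `|` `[u, +oo[.
  apply/seteqP; split=> r // _ /=.
  by rewrite !in_itv /= andbT; apply/orP; exact: le_total.
apply: withinU_continuous.
- exact: itv_closed_ends_closed.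
- exact: itv_closed_ends_closed.
- apply: subspace_eq_continuous (continuous_subspaceT cf) => r.
  by rewrite inE /= in_itv /= /from_subspace => ->.
- apply: subspace_eq_continuous (continuous_subspaceT cg) => r.
  rewrite inE /= in_itv /= andbT /from_subspace => ur; case: ifP => // ru.
  by have -> : r = u by apply/le_anti; rewrite ru.
Qed.

Lemma itv01P r : (r \in `[0, 1]) = (0 <= r <= 1). Proof. by rewrite in_itv. Qed.

Lemma continuous_path T (g : R -> T) :
  {within `[0, 1], continuous g} -> continuous (g \o clamp 0 1).
Proof.
move=> cg; apply: continuous_comp_within cg; first exact: clamp_continuous.
by move=> r /=; rewrite in_itv /=; exact: clamp_itv.
Qed.

End Line.

(** * Locally path connected spaces *)

Section LocallyPathConnected.
Variables (R : realType) (T : topologicalType).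
Hypothesis lpcT : locally_path_connected R T.

Lemma path_connected_component (A U : set T) (x y : T) :
  path_connected R U -> U `<=` A -> U x -> U y -> connected_component A x y.
Proof.
move=> pU UA Ux Uy; have [g [[cg gU] g0 g1]] := pU _ _ Ux Uy.
have im r : r \in `[0, 1] -> (g @` `[0, 1]) (g r) by exists r.
apply: (@connected_component_max _ _ (g @` `[0, 1])).
- by rewrite -g0; apply: im; rewrite itv01P lexx ler01.
- exact: subset_trans gU UA.
- by apply: connected_continuous_connected cg; exact: segment_connected.
- by rewrite -g1; apply: im; rewrite itv01P lexx ler01.
Qed.

Lemma component_open (A : set T) (x : T) :
  open A -> open (connected_component A x).
Proof.
move=> oA; rewrite openE => y xy.
have Ay := connected_component_sub xy.
have [U [oU Uy pU UA]] := lpcT (open_nbhs_nbhs (conj oA Ay)).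
apply: filterS (open_nbhs_nbhs (conj oU Uy)) => z Uz.
by apply: connected_component_trans xy _;
   exact: path_connected_component pU _ _ _.
Qed.

(** Being reachable from [x] by a path in [D] is a locally constant property of
    the end point, since path connected neighbourhoods allow one to prolong
    paths in both directions. *)
Lemma connected_open_path (D : set T) (x y : T) :
  open D -> connected D -> D x -> D y ->
  exists h : R -> T, [/\ continuous h, h 0 = x, h 1 = y & forall r, D (h r)].
Proof.
move=> oD cD Dx Dy.
pose P z := exists h : R -> T,
  [/\ continuous h, h 0 = x, h 1 = z & forall r, D (h r)].
have ext z w U : path_connected R U -> U `<=` D -> U z -> U w -> P z -> P w.
  move=> pU UD Uz Uw [h [ch h0 h1 hD]].
  have [g [[cg gU] g0 g1]] := pU _ _ Uz Uw.
  pose k r := if r <= 1 / 2 then h (2 * r) else (g \o clamp 0 1) (2 * r - 1).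
  have half : 2 * (1 / 2) = 1 :> R by rewrite mul1r mulfV // pnatr_eq0.
  have k0 : clamp 0 1 (2 * (1 / 2) - 1) = 0 :> R.
    by rewrite half subrr clamp_id // lexx ler01.
  exists k; split.
  - apply: continuous_glue.
    + move=> r; apply: (continuous_comp (@mulrl_continuous R 2 r)).
      exact: ch.
    + move=> r; apply: (@continuous_comp R R T (fun r => 2 * r - 1)).
        by apply: cvgB; [exact: mulrl_continuous | exact: cvg_cst].
      exact: (continuous_path cg).
    + by rewrite /= k0 g0 -h1 half.
  - by rewrite /k divr_ge0 // mulr0.
  - rewrite /k ifF; last first.
      by apply/negbTE; rewrite -ltNge ltr_pdivrMr // mul1r ltr1n.
    by rewrite /= mulr1 -[2]/(1 + 1) addrK clamp_id // lexx ler01.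
  - move=> r; rewrite /k; case: ifP => _ //=; apply/UD/gU.
    by exists (clamp 0 1 (2 * r - 1)) => //=; rewrite in_itv; exact: clamp_itv.
have /(_ x y Dx Dy) : forall x y, D x -> D y -> P x -> P y.
  apply: connected_locally_constant cD _ => z Dz.
  have [U [oU Uz pU UD]] := lpcT (open_nbhs_nbhs (conj oD Dz)).
  apply: filterS (open_nbhs_nbhs (conj oU Uz)) => w Uw _.
  by split; apply: ext pU UD _ _.
apply; exists (cst x); split=> // r; exact: cst_continuous.
Qed.

End LocallyPathConnected.

(** * Lifting paths over the ordinary locus *)

Section OrdinaryLocus.
Variables (X Y : topologicalType) (p : X -> Y).

(** A homeomorphism of a component onto [U] is used through its inverse, a
    section [s] of [p] over [U]. The section composed with a path in [U] is a
    lift, and the last clause forces every lift in the component to be of this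
    form; these two facts give existence and uniqueness of lifts. *)
Lemma ordinary_section (y : Y) : ordinary_locus p y ->
  exists2 U, open_nbhs y U & forall x, U (p x) -> exists s : Y -> X,
    [/\ {within U, continuous s}, forall z, U z -> p (s z) = z
      & forall w, connected_component (p @^-1` U) x w -> s (p w) = w].
Proof.
move=> [U [Uy hU]]; exists U => // x Ux.
have [|h [[ch [g [cg hK gK]]] hE]] := hU (connected_component (p @^-1` U) x).
  by exists x.
have sE (z : U) : valL_ x (set_val \o g) (set_val z) = set_val (g z).
  by rewrite -[RHS]/((set_val \o g) z) -[in RHS](@valLK _ _ x _ (set_val \o g)).
exists (valL_ x (set_val \o g)); split.
- apply/subspace_valL_continuousP' => z.
  by apply: continuous_comp; [exact: cg | exact: initial_continuous].
- move=> z Uz; have := sE (SigSub (mem_set Uz)); rewrite /= => ->.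
  by rewrite -hE gK.
- move=> w Cw.
  pose w' : connected_component (p @^-1` U) x := SigSub (mem_set Cw).
  by rewrite -[w in p w]/(set_val w') -hE sE hK.
Qed.

Hypothesis p_cont : continuous p.
Variable R : realType.

(** Having a lift on the interval from [0] to [u] is a locally constant property
    of [u]: near [u] the path stays in one evenly covered open set, whose
    section prolongs any lift that comes close enough to [u]. *)
Lemma lift_exists (g : R -> Y) (x0 : X) (t : R) :
  continuous g -> (forall r, ordinary_locus p (g r)) -> p x0 = g 0 ->
  0 <= t ->
  exists h : R -> X,
    [/\ continuous h, h 0 = x0 & forall r, 0 <= r <= t -> p (h r) = g r].
Proof.
move=> cg gO px0 t0.
pose P u := exists h : R -> X,
    [/\ continuous h, h 0 = x0 & forall r, 0 <= r <= u -> p (h r) = g r].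
have [h hP] : P t; last by exists h.
apply: (@connected_locally_constant R `[0, +oo[%classic P _ _ 0 t).
- by apply/connected_intervalP; exact: interval_is_interval.
- move=> u u0; have [U [oU Ugu] hU] := ordinary_section (gO u).
  have /nbhs_ballP[e /= e0 eU] : nbhs u (g @^-1` U).
    by apply: cg; exact: open_nbhs_nbhs.
  suff ext a b : 0 <= a -> ball u e a -> ball u e b -> P a -> P b.
    near=> v => v0; have uv : ball u e v by near: v; exact: nbhsx_ballx.
    have uu : ball u e u by exact: ballxx.
    by move: u0 v0; rewrite /= !in_itv /= !andbT => u0 v0; split; exact: ext.
  move=> a0 ua ub [h [ch h0 hg]].
  have [ba|/ltW ab] := leP b a.
    exists h; split=> // r /andP[r0 rb]; apply: hg.
    by rewrite r0 (le_trans rb).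
  have gU r : a <= r <= b -> U (g r).
    move=> /andP[ar rb]; apply: eU; move: ua ub.
    rewrite /ball /= !ltr_distlC => /andP[au _] /andP[_ bu].
    by rewrite (lt_le_trans au ar) (le_lt_trans rb bu).
  have aa : a <= a <= b by rewrite lexx.
  have hga : p (h a) = g a by apply: hg; rewrite a0 lexx.
  have [|s [cs ps sp]] := hU (h a); first by rewrite hga; exact: gU.
  (* The clamp keeps the argument of [s] in [U] for every [r], so that [s] is
     only used where it is continuous. *)
  exists (fun r => if r <= a then h r else s (g (clamp a b r))); split.
  + apply: continuous_glue ch _ _.
      apply: (@continuous_comp_within _ _ _ U (g \o clamp a b) s) => //.
      * move=> r; apply: continuous_comp; first exact: clamp_continuous.
        exact: cg.
      * by move=> r; apply/gU/clamp_itv.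
    rewrite /= clamp_id // -hga sp //; apply: connected_component_refl.
    by rewrite /preimage /= hga; exact: gU.
  + by rewrite a0.
  + move=> r /andP[r0 rb]; case: ifP => [ra|/negbT]; first by rewrite hg ?r0.
    rewrite -ltNge => /ltW ar; rewrite clamp_id ?ar // ps //.
    by apply: gU; rewrite ar.
- by rewrite /= in_itv /= lexx.
- by rewrite /= in_itv /= andbT.
- exists (cst x0); split=> //; first by move=> r; exact: cst_continuous.
  by move=> r /le_anti <-.
Unshelve. all: by end_near. Qed.

Hypotheses (X_lpc : locally_path_connected R X) (X_T2 : hausdorff_space X).

(** Two lifts agree on an open set of times, as near a common value both are
    the image of the same path by a local section, and on a closed one, as [X]
    is Hausdorff. *)
Lemma lift_unique (h k : R -> X) :
  continuous h -> continuous k -> (forall r, ordinary_locus p (p (h r))) ->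
  (forall r, p (h r) = p (k r)) -> h 0 = k 0 -> forall r, h r = k r.
Proof.
move=> ch ck hO hk hk0 r.
apply: (@connected_locally_constant _ setT (fun r => h r = k r)
  (@connected_line R) _ 0) => // t _.
have [htE|ht] := pselect (h t = k t); last first.
  have := X_T2; rewrite open_hausdorff => /(_ _ _ (introN eqP ht)).
  move=> [[A B] /= [/set_mem Aht /set_mem Bkt] [oA oB /eqP AB]].
  near=> u => _; split=> // huE; exfalso.
  suff: set0 (h u) by [].
  rewrite -AB; split; last rewrite huE.
    by near: u; apply: ch; exact: open_nbhs_nbhs.
  by near: u; apply: ck; exact: open_nbhs_nbhs.
have [U [oU Uht] hU] := ordinary_section (hO t).
have [s [_ _ sp]] := hU _ Uht.
have nC : nbhs (h t) (connected_component (p @^-1` U) (h t)).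
  apply: open_nbhs_nbhs; split; last exact: connected_component_refl.
  by apply: (component_open X_lpc); apply: open_comp => // z _; exact: p_cont.
near=> u => _; split=> // _.
rewrite -(sp (h u)) ?hk ?sp //.
  by near: u; apply: ck; rewrite -htE.
by near: u; exact: ch.
Unshelve. all: by end_near. Qed.

Variables (S : set Y) (ahat : X).
Hypothesis S_ord : ~` S = ordinary_locus p.

Lemma path_lift_is_lift (g : R -> Y) :
  path_in (~` S) g -> g 0 = p ahat -> is_lift p ahat g (path_lift p ahat g).
Proof.
move=> [cg gS] g0.
have [r|||h [ch h0 hg]] :=
  @lift_exists (g \o clamp 0 1) ahat 1 (continuous_path cg).
- rewrite -S_ord; apply: gS; exists (clamp 0 1 r) => //=.
  by rewrite in_itv; exact: clamp_itv.
- by rewrite /= clamp_id ?lexx ?ler01 // g0.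
- exact: ler01.
apply: (@xgetPex _ _ [set h | is_lift p ahat g h]); exists h; split=> //.
  exact: continuous_subspaceT.
by move=> r; rewrite itv01P => r01; rewrite hg //= clamp_id.
Qed.

(** A path in [Ord(X)] lifts its own projection, so uniqueness of lifts
    identifies the end point of the chosen lift. *)
Lemma path_lift_proj (h : R -> X) :
  continuous h -> (forall r, ordinary_locus p (p (h r))) -> h 0 = ahat ->
  path_lift p ahat (p \o h) 1 = h 1.
Proof.
move=> ch hO h0.
have [|/=|ck k0 kh] := @path_lift_is_lift (p \o h).
- split; last by move=> _ [r _ <-]; rewrite S_ord; exact: hO.
  apply: continuous_subspaceT => r.
  by apply: continuous_comp; [exact: ch | exact: p_cont].
- by rewrite h0.
have c01 (r : R) : clamp 0 1 r \in `[0, 1] by rewrite itv01P; exact: clamp_itv.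
have clamp1 (r : R) : 0 <= r <= 1 -> clamp 0 1 r = r by exact: clamp_id.
have : (path_lift p ahat (p \o h) \o clamp 0 1) 1 = (h \o clamp 0 1) 1.
  apply: lift_unique => [||r|r|]; first exact: (continuous_path ck).
  - by move=> r; apply: continuous_comp; [exact: clamp_continuous | exact: ch].
  - by rewrite /= kh //=; exact: hO.
  - by rewrite /= kh.
  - by rewrite /= !clamp1 ?lexx ?ler01 // k0 h0.
by rewrite /= !clamp1 ?lexx ?ler01.
Qed.

End OrdinaryLocus.

(** * Components over the neighbourhoods of a point *)

Section FibreComponents.
Variables (X Y : topologicalType) (p : X -> Y).

Lemma is_component_eq (A C : set X) (x : X) :
  is_component A C -> C x -> C = connected_component A x.
Proof. by move=> [y Ay ->] /same_connected_component. Qed.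

Lemma connected_componentS (A A' : set X) (x : X) :
  A `<=` A' -> connected_component A x `<=` connected_component A' x.
Proof.
by move=> AA' y [C [Cx CA cC] Cy]; exists C => //; split=> // z /CA /AA'.
Qed.

(** The topology only has the components of preimages as a subbase; over a
    common smaller neighbourhood of [p x], the component of [x] lies in each of
    the finitely many components used, hence in their intersection. *)
Lemma spread_component_basis (B : set (set Y)) (x : X) (W : set X) :
  spread p -> nbhs_basis (p x) B -> nbhs x W ->
  exists2 U, B U & connected_component (p @^-1` U) x `<=` W.
Proof.
move=> [_ gen] [_ Bb]; rewrite nbhsE => -[O [oO Ox] OW].
have [F FG OE] := iffLR (gen O) oO.
have [A FD Dx] : (\bigcup_(A in F) A) x by rewrite -OE.
have [D DG DE] := FG _ FD; rewrite -{A}DE in FD Dx.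
(* The neighbourhoods [U] are to be chosen by a function defined on all sets
   [C], hence the case distinction. *)
have sub (C : set X) : exists U : set Y, C \in D -> nbhs (p x) U /\
    forall V, V `<=` U -> connected_component (p @^-1` V) x `<=` C.
  have [CD|nCD] := boolP (C \in D); last by exists setT.
  have /set_mem [U oU Ccomp] := DG _ CD; have Cx : C x := Dx _ CD.
  have CE := is_component_eq Ccomp Cx.
  exists U => _; split.
    apply: open_nbhs_nbhs; split=> //; move: Cx.
    by rewrite CE => /connected_component_sub.
  by move=> V VU; rewrite CE; apply: connected_componentS => z /VU.
have [f fP] := choice sub.
have /Bb [U BU Uf] : nbhs (p x) (\bigcap_(C in [set` D]) f C).
  by apply: filter_bigI => C CD; have [] := fP C CD.
exists U => // z Uz; apply: OW; rewrite OE.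
exists (\bigcap_(C in [set` D]) C) => // C CD.
by have [_] := fP C CD; apply; last exact: Uz; move=> y /Uf /(_ _ CD).
Qed.

End FibreComponents.

(** * Classes of paths as components *)

Section EndComponent.
Variables (R : realType) (X Y : topologicalType) (p : X -> Y).
Variables (S : set Y) (a : Y) (ahat : X).
Hypotheses (X_adm : admissible R X) (p_branched : branched_over p S).
Hypotheses (Sa : ~ S a) (p_ahat : p ahat = a).

Let p_cont : continuous p.
Proof. by have [[[[]]]] := p_branched. Qed.

Let S_ord : ~` S = ordinary_locus p.
Proof. by have [_ ->] := p_branched; rewrite setCK. Qed.

(** The component in which the lifts of the paths of class [c] end; it does not
    depend on the representative, see [end_component_class]. *)
Definition end_component (U : set Y) (c : pi1 R p S a ahat U) : set X :=
  connected_component (p @^-1` U) (path_lift p ahat (set_val (repr c)) 1).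

Lemma end_component_class (U : set Y) (g : @paths_into R Y S a U) :
  end_component (pi1_class p ahat g) =
  connected_component (p @^-1` U) (path_lift p ahat (set_val g) 1).
Proof.
have /eqmodP/asboolP // : pi1_class p ahat (repr (pi1_class p ahat g))
  = pi1_class p ahat g by rewrite /pi1_class reprK.
Qed.

Lemma end_component_inj (U : set Y) : injective (@end_component U).
Proof.
move=> c d cd; rewrite -(reprK c) -(reprK d).
by apply/eqmodP/asboolP.
Qed.

Lemma path_lift_end (U : set Y) (g : @paths_into R Y S a U) :
  U (p (path_lift p ahat (set_val g) 1)).
Proof.
have [gS g0 gU] := set_valP g.
have [_ _ ->] // : is_lift p ahat (set_val g) (path_lift p ahat (set_val g)).
  by apply: (path_lift_is_lift S_ord) => //; rewrite p_ahat; exact: g0.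
by rewrite itv01P lexx ler01.
Qed.

Lemma end_component_is_component (U : set Y) (c : pi1 R p S a ahat U) :
  is_component (p @^-1` U) (end_component c).
Proof. by eexists; last reflexivity; exact: path_lift_end. Qed.

Lemma end_component_bonding (U V : set Y) (UV : U `<=` V)
    (c : pi1 R p S a ahat U) :
  end_component c `<=` end_component (bonding UV c).
Proof.
rewrite /bonding end_component_class; apply: connected_componentS => x.
exact: UV.
Qed.

(** Density of [Ord(X)] gives a target point in the given component, and local
    connectedness of [Ord(X)] in [X], applied to the whole of [X], makes
    [Ord(X)] connected, so that the target can be joined to [ahat]. *)
Lemma end_component_surj (U : set Y) (x : X) : open U -> U (p x) ->
  exists c : pi1 R p S a ahat U,
    end_component c = connected_component (p @^-1` U) x.
Proof.
move=> oU Ux; have [[_ _ _ _ [oD dD lcD] _] _] := p_branched.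
have lpcX := admissible_lpc X_adm.
set C := connected_component _ _.
have oC : open C.
  by apply: (component_open lpcX); apply: open_comp => // z _; exact: p_cont.
have [z [Cz Dz]] : C `&` p @^-1` ordinary_locus p !=set0.
  by apply: dD oC; exists x; exact: connected_component_refl.
have cD : connected (p @^-1` ordinary_locus p).
  rewrite -[_ @^-1` _]setTI; apply: lcD; first exact: openT.
  by have [[]] := p_branched.
have Da : (p @^-1` ordinary_locus p) ahat by rewrite -S_ord /preimage /= p_ahat.
have [h [ch h0 h1 hD]] := connected_open_path lpcX oD cD Da Dz.
have pathU : p \o h \in @paths_into R Y S a U.
  rewrite inE; split=> /=; last 2 first.
  - by rewrite h0.
  - by rewrite h1; exact: (connected_component_sub Cz).
  split; last by move=> _ [r _ <-]; rewrite S_ord; exact: hD.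
  apply: continuous_subspaceT => r.
  by apply: continuous_comp; [exact: ch | exact: p_cont].
exists (pi1_class p ahat (SigSub pathU)); rewrite end_component_class /=.
rewrite (path_lift_proj p_cont lpcX (admissible_hausdorff X_adm) S_ord) //.
by rewrite h1; apply/esym/same_connected_component.
Qed.

(** * The fibre as a limit *)

Section Fibre.
Hypothesis Y_T2 : hausdorff_space Y.
Variables (b : Y) (B : set (set Y)).
Hypotheses (B_basis : nbhs_basis b B)
  (B_oc : forall U, B U -> open U /\ connected U).

(** The correspondence between points of the fibre and compatible families of
    classes, as a relation: the maps in both directions are then obtained by
    choice, and are inverse to each other because each side determines the
    other. *)
Definition ends_at (x : X) (s : pi1_limit R p S a ahat B) : Prop :=
  forall U : B, end_component (set_val s U) x.

Let B_nbhs (U : B) : open_connected_nbhs b (set_val U).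
Proof.
have BU := set_valP U; have [oU cU] := B_oc BU.
by split=> //; split=> //; apply: nbhs_singleton; apply: (proj1 B_basis).
Qed.

Lemma end_component_eq (U : set Y) (c : pi1 R p S a ahat U) (x : X) :
  end_component c x -> end_component c = connected_component (p @^-1` U) x.
Proof. exact: is_component_eq (end_component_is_component c). Qed.

Lemma end_component_compat (s : pi1_limit R p S a ahat B) (U V : B) :
  set_val U `<=` set_val V ->
  end_component (set_val s U) `<=` end_component (set_val s V).
Proof.
move=> UV.
have <- : bonding UV (set_val s U) = set_val s V := set_valP s U V UV.
exact: end_component_bonding.
Qed.

Lemma ends_at_exists (x : X) : p x = b -> exists s, ends_at x s.
Proof.
move=> px.
have [s sx] : exists s : forall U : B, pi1 R p S a ahat (set_val U),
    forall U, end_component (s U) x.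
  have c_ (U : B) : {c : pi1 R p S a ahat (set_val U) | end_component c x}.
    apply: cid; have [[oU Ub] _] := B_nbhs U.
    have [|c cE] := @end_component_surj (set_val U) x oU; first by rewrite px.
    exists c; rewrite cE; apply: connected_component_refl.
    by rewrite /preimage /= px.
  by exists (fun U => sval (c_ U)) => U; exact: (svalP (c_ U)).
have sP : s \in pi1_limit R p S a ahat B.
  rewrite inE => U V UV; apply: end_component_inj.
  rewrite (end_component_eq (sx V)); apply: end_component_eq.
  exact: end_component_bonding (sx U).
by exists (SigSub sP) => U; exact: sx.
Qed.

Lemma ends_at_unique (x : X) s t : ends_at x s -> ends_at x t -> s = t.
Proof.
move=> xs xt; apply: val_inj; apply: functional_extensionality_dep => U.
apply: end_component_inj.
by rewrite (end_component_eq (xs U)) (end_component_eq (xt U)).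
Qed.

Lemma ends_at_basis (x : X) (s : pi1_limit R p S a ahat B) (W : set X) :
  p x = b -> ends_at x s -> nbhs x W ->
  exists U : B, end_component (set_val s U) `<=` W.
Proof.
move=> px xs nW; have [[[sp _]]] := p_branched => _ _ _ _ _ _.
have [|U BU UW] := @spread_component_basis _ _ p B x W sp _ nW.
  by rewrite px.
exists (SigSub (mem_set BU)); rewrite (end_component_eq (xs _)); exact: UW.
Qed.

Lemma ends_at_point_unique (x y : X) s :
  p x = b -> ends_at x s -> ends_at y s -> x = y.
Proof.
move=> px xs ys; apply: contrapT => /eqP xy.
have := admissible_hausdorff X_adm; rewrite open_hausdorff => /(_ _ _ xy).
move=> [[V W] /= [/set_mem Vx /set_mem Wy] [oV oW /eqP VW]].
have [U UV] := ends_at_basis px xs (open_nbhs_nbhs (conj oV Vx)).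
suff : set0 y by [].
rewrite -VW; split=> //; exact: UV.
Qed.

(** Completeness needs a choice of components over all connected neighbourhoods
    of [b], whereas [s] only provides one over the members of [B]. Over [W] one
    takes the component of [p @^-1` W] that contains the components given by
    [s] over all members of [B] inside [W]; these lie in one component because
    any two members of [B] contain a third. *)
Lemma ends_at_point_exists s : exists2 x, p x = b & ends_at x s.
Proof.
pose chi (W : set Y) := [set z | exists2 U : B, set_val U `<=` W &
  exists2 w, end_component (set_val s U) w &
    connected_component (p @^-1` W) w z].
have pts (U : B) : end_component (set_val s U) !=set0.
  by eexists; apply: connected_component_refl; exact: path_lift_end.
(* [chi W] is defined as a union, which makes it monotone by construction; it
   is a single component by [chiE]. *)
have chiE (W : set Y) (U : B) w : set_val U `<=` W ->
    end_component (set_val s U) w -> chi W = connected_component (p @^-1` W) w.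
  move=> UW Uw; apply/seteqP; split=> [z [V VW [v Vv vz]]|z wz]; last first.
    by exists U => //; exists w.
  have [T BT TUV] : exists2 T, B T & T `<=` set_val U `&` set_val V.
    by apply: (proj2 B_basis); apply: filterI; apply: open_nbhs_nbhs;
       exact: (proj1 (B_nbhs _)).
  pose T' : B := SigSub (mem_set BT).
  have [t Tt] := pts T'.
  have toW (U' : B) u : set_val U' `<=` W -> T `<=` set_val U' ->
      end_component (set_val s U') u -> connected_component (p @^-1` W) u t.
    move=> U'W TU' U'u.
    have U't : end_component (set_val s U') t.
      exact: (@end_component_compat s T' U' TU').
    apply: (@connected_componentS _ (p @^-1` set_val U')).
      by move=> ? /U'W.
    by rewrite -(end_component_eq U'u).
  have TU : T `<=` set_val U by move=> ? /TUV[].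
  have TV : T `<=` set_val V by move=> ? /TUV[].
  apply: connected_component_trans (toW U w UW TU Uw) _.
  by apply: connected_component_trans vz;
     apply: connected_component_sym; exact: toW VW TV Vv.
have small (W : set Y) : nbhs b W -> exists U : B, set_val U `<=` W.
  by move=> /(proj2 B_basis)[U BU UW]; exists (SigSub (mem_set BU)).
have [[[_ complete] surj _ _ _ _] _] := p_branched.
have [|W [oW _]|V W _ _ VW z [U UV [w Uw wz]]|x xchi] := complete b chi.
- by apply: subset_closure; have [x _ <-] := surj b I; exists x.
- have [U UW] := small W (open_nbhs_nbhs oW); have [w Uw] := pts U.
  exists w; last exact: chiE UW Uw.
  exact/UW/(connected_component_sub Uw).
- exists U; first exact: subset_trans UV VW.
  by exists w => //; apply: connected_componentS wz => ? /VW.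
have xs : ends_at x s.
  move=> U; have [w Uw] := pts U.
  by rewrite (end_component_eq Uw) -(chiE _ _ _ _ Uw) //;
     exact: xchi (B_nbhs U).
exists x => //; apply: contrapT => /eqP pxb.
have := Y_T2; rewrite open_hausdorff => /(_ _ _ pxb).
move=> [[V W] /= [/set_mem Vx /set_mem Wb] [oV oW /eqP VW]].
have [U UW] := small W (open_nbhs_nbhs (conj oW Wb)).
suff : set0 (p x) by [].
rewrite -VW; split=> //; apply: UW.
exact: connected_component_sub (xs U).
Qed.

Lemma fibre_homeomorphic :
  homeomorphic (p @^-1` [set b]) (pi1_limit R p S a ahat B).
Proof.
have [F FP] := choice (fun x : p @^-1` [set b] => ends_at_exists (set_valP x)).
have ptP s : exists x : p @^-1` [set b], ends_at (set_val x) s.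
  have [x px xs] := ends_at_point_exists s.
  by exists (SigSub (mem_set (px : (p @^-1` [set b]) x))).
have [G GP] := choice ptP.
exists F; split; last exists G; [|split].
- apply: continuous_comp_initial; apply: continuous_prod_topology.
  move=> U x W /nbhs_singleton Wx.
  have oC : open (end_component (set_val (F x) U)).
    have [[oU _] _] := B_nbhs U.
    have [z _ ->] := end_component_is_component (set_val (F x) U).
    apply: (component_open (admissible_lpc X_adm)).
    by apply: open_comp => // z' _; exact: p_cont.
  have : nbhs x (set_val @^-1` end_component (set_val (F x) U)).
    by apply: initial_continuous; apply: open_nbhs_nbhs; split=> //; exact: FP.
  apply: filterS => z Cz; rewrite /preimage /=.
  have -> // : set_val (F z) U = set_val (F x) U.
  apply: end_component_inj.
  by rewrite (end_component_eq (FP z U)) (end_component_eq Cz).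
- apply: continuous_comp_initial => s W nW.
  have [U UW] := ends_at_basis (set_valP (G s)) (GP s) nW.
  have nU := @nbhs_prod_discrete B (fun V => pi1 R p S a ahat (set_val V))
    (set_val s) U.
  have : nbhs s (set_val @^-1` [set t | t U = set_val s U]).
    exact: initial_continuous nU.
  by apply: filterS => t tU; apply: UW; rewrite -tU; exact: GP.
- move=> x; apply: val_inj.
  exact: ends_at_point_unique (set_valP (G (F x))) (GP (F x)) (FP x).
- by move=> s; apply: ends_at_unique (FP _) (GP s).
Qed.

End Fibre.

End EndComponent.

Theorem proposition2p28 (R : realType) (X Y : topologicalType)
    (hX : admissible R X) (hY : admissible R Y)
    (p : X -> Y) (S : set Y) (hp : branched_over p S)
    (a : Y) (ha : ~ S a) (ahat : X) (hahat : p ahat = a)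
    (b : Y) (B : set (set Y))
    (hB : nbhs_basis b B) (hBoc : forall U, B U -> open U /\ connected U) :
  homeomorphic (p @^-1` [set b]) (pi1_limit R p S a ahat B).
Proof.
exact: (fibre_homeomorphic hX hp ha hahat (admissible_hausdorff hY) hB hBoc).
Qed.
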